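(* Let $G$ be a connected graph with $\delta(G)\geq 1$. Then $$\max\{\gamma_t(G),\gamma_t(L(G))\}\leq \gamma_{tm}(G)\leq \gamma_t(L(G))+\gamma_t(G),$$ and the bounds are tight, i.e. for each of the two inequalities there is such a graph $G$ for which it holds with equality.
   Context: All graphs are non-empty, finite, undirected and simple; $\delta(G)$ is the minimum degree of $G$. For a graph $G=(V,E)$, the line graph $L(G)$ has vertex set $E$, two distinct edges being adjacent in $L(G)$ when they share an endpoint in $G$. A total dominating set of a graph $H$ is a set $S\subseteq V(H)$ such that every vertex of $H$ (including those in $S$) is adjacent to a vertex in $S$; the total domination number $\gamma_t(H)$ is the minimum cardinality of a total dominating set of $H$. A total mixed dominating set of a graph $G=(V,E)$ with $\delta(G)\geq 1$ is a set $S\subseteq V\cup E$ such that every element of $V\cup E$ (including those in $S$) is either adjacent or incident to an element of $S$ (two vertices are adjacent if joined by an edge; two distinct edges are adjacent if they share an endpoint; a vertex and an edge are incident if the vertex is an endpoint of the edge; no element is adjacent or incident to itself). The total mixed domination number $\gamma_{tm}(G)$ is the minimum cardinality of a total mixed dominating set of $G$. *)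

(* Defs.v *)
From HB Require Import structures.
From mathcomp Require Import all_boot.

Set Implicit Arguments.
Unset Strict Implicit.
Unset Printing Implicit Defensive.

Record sgraph := SGraph {
  vertex :> finType;
  adj : rel vertex;
  adj_sym : symmetric adj;
  adj_irr : irreflexive adj
}.

Definition degree (G : sgraph) (x : G) : nat := #|[set y | adj x y]|.

(* The neutral element #|G| exceeds every degree, so for a non-empty graph it
   does not affect the minimum. *)
Definition min_degree (G : sgraph) : nat := \big[minn/#|G|]_(x : G) degree x.

Definition connected (G : sgraph) : Prop :=
  forall x y : G, connect (@adj G) x y.

Definition is_edge (G : sgraph) (e : {set G}) : bool :=
  [exists x, exists y, adj x y && (e == [set x; y])].

Definition edge (G : sgraph) : finType := {e : {set G} | is_edge e}.

Definition incident (G : sgraph) (x : G) (e : edge G) : bool := x \in val e.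

Definition edge_adj (G : sgraph) : rel (edge G) :=
  fun e f => (e != f) && [exists x, incident x e && incident x f].

Lemma edge_adj_sym (G : sgraph) : symmetric (@edge_adj G).
Proof.
move=> e f; rewrite /edge_adj eq_sym; congr (_ && _).
by apply: eq_existsb => x; rewrite andbC.
Qed.

Lemma edge_adj_irr (G : sgraph) : irreflexive (@edge_adj G).
Proof. by move=> e; rewrite /edge_adj eqxx. Qed.

Definition line_graph (G : sgraph) : sgraph :=
  SGraph (@edge_adj_sym G) (@edge_adj_irr G).

Definition total_dominating (H : sgraph) (S : {set H}) : bool :=
  [forall x, exists y in S, adj x y].

(* A graph with an isolated vertex has no total dominating set; the minimum
   over the empty family then takes the junk value #|H|. *)
Definition gamma_t (H : sgraph) : nat :=
  \big[minn/#|H|]_(S : {set H} | total_dominating S) #|S|.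

(* V and E are joined as a disjoint sum. *)
Definition element (G : sgraph) : finType := (vertex G + edge G)%type.

Definition mixed_adj (G : sgraph) (a b : element G) : bool :=
  match a, b with
  | inl x, inl y => adj x y
  | inl x, inr e => incident x e
  | inr e, inl x => incident x e
  | inr e, inr f => edge_adj e f
  end.

Definition total_mixed_dominating (G : sgraph) (S : {set element G}) : bool :=
  [forall a, exists b in S, mixed_adj a b].

(* When the minimum degree is positive the set of all elements is total mixed
   dominating, so the minimum is over a non-empty family. *)
Definition gamma_tm (G : sgraph) : nat :=
  \big[minn/#|element G|]_(S : {set element G} | total_mixed_dominating S) #|S|.

(* Main.v *)
Require Import Defs.
From mathcomp Require Import all_boot.

Set Implicit Arguments.
Unset Strict Implicit.
Unset Printing Implicit Defensive.

(** The two lower bounds are one statement.  In the mixed setting the elements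
    are of two kinds, and each kind cuts the other into cliques: an edge has two
    adjacent endpoints, and the edges at a vertex are pairwise adjacent in the
    line graph.  Moreover two elements of one kind are adjacent exactly when
    they are distinct and incident to a common element of the other kind.  So
    let [H] be the graph on the kind that is kept, and let every member of
    the other kind be a clique of [H].  A greedy process
    ([exchange_dominating]) trades the cliques of a total mixed dominating set
    one by one for a single vertex of [H] each, and ends with a total dominating
    set of [H] that is no larger.  It needs [H] to have no isolated vertex; the
    only connected graph whose line graph violates this is a single edge, for
    which [gamma_t] of the line graph is at most 1 ([isolated_edge]).

    The upper bound holds because total dominating sets of [G] and of its line
    graph together form a total mixed dominating set; the argument is arranged
    to cover the degenerate case in which all edges are taken.

    A triangle attains the lower bound, all parameters being 2.  For the upper
    bound, take two adjacent hubs, each with a pendant leaf and with two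
    triangles glued at it.  The hubs dominate all vertices, and four spokes
    dominate all edges.  The two leaves and the four triangle edges opposite to
    the hubs have pairwise disjoint neighbourhoods among all elements, so a
    total mixed dominating set has at least 6 = 4 + 2 elements
    ([packing_leq_gamma_tm]). *)

(** * Minima over finite families *)

Lemma leq_bigminn (I : Type) (r : seq I) (P : pred I) (F : I -> nat) d m :
  (m <= \big[minn/d]_(i <- r | P i) F i)
    = (m <= d) && all (fun i => P i ==> (m <= F i)) r.
Proof.
elim: r => [|i r IHr]; first by rewrite big_nil andbT.
by rewrite big_cons /=; case: (P i); rewrite //= leq_min IHr andbCA.
Qed.

Lemma bigminn_leq (I : finType) (P : pred I) (F : I -> nat) d i :
  P i -> \big[minn/d]_(j | P j) F j <= F i.
Proof.
move=> Pi; have := leqnn (\big[minn/d]_(j | P j) F j).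
rewrite leq_bigminn => /andP[_ /allP/(_ i)].
by rewrite mem_index_enum Pi => /(_ isT).
Qed.

Lemma bigminn_geq (I : finType) (P : pred I) (F : I -> nat) d m :
  m <= d -> (forall i, P i -> m <= F i) -> m <= \big[minn/d]_(i | P i) F i.
Proof.
by move=> md mF; rewrite leq_bigminn md; apply/allP=> i _; apply/implyP/mF.
Qed.

Lemma min_degree_gt0 (G : sgraph) :
  0 < #|G| -> (1 <= min_degree G) <-> (forall x : G, exists y, adj x y).
Proof.
move=> G0; split=> [d1 x | noiso].
  have /card_gt0P[y] : 0 < degree x by apply: leq_trans d1 (bigminn_leq _ _ _).
  by rewrite inE; exists y.
apply: bigminn_geq => // x _; have [y xy] := noiso x.
by apply/card_gt0P; exists y; rewrite inE.
Qed.

Section TotalDomination.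
Variable H : sgraph.
Implicit Types (S : {set H}).

Lemma total_dominatingP S :
  reflect (forall x, exists2 y, y \in S & adj x y) (total_dominating S).
Proof. by apply: (iffP forallP) => h x; apply/exists_inP/h. Qed.

Lemma gamma_t_leq S : total_dominating S -> gamma_t H <= #|S|.
Proof. by move=> domS; apply: bigminn_leq. Qed.

Lemma gamma_t_leq_card : gamma_t H <= #|H|.
Proof.
have := leqnn (gamma_t H).
by rewrite leq_bigminn => /andP[].
Qed.

(** The second alternative accounts for graphs with isolated vertices. *)
Lemma gamma_t_witness :
  exists2 S : {set H}, gamma_t H = #|S| & total_dominating S \/ S = setT.
Proof.
rewrite /gamma_t.
elim/big_rec: _ => [|S m domS [T -> domT]].
  by exists setT; [rewrite cardsT | right].
by case: leqP => _; [exists S; last left | exists T].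
Qed.

Lemma total_dominating_setT :
  (forall x : H, exists y, adj x y) -> total_dominating [set: H].
Proof.
by move=> noiso; apply/total_dominatingP=> x; have [y] := noiso x; exists y.
Qed.

(** A vertex [x] has a neighbour [y] in the set, and [y] is not its own
    neighbour. *)
Lemma total_dominating_gt1 S : 0 < #|H| -> total_dominating S -> 1 < #|S|.
Proof.
move=> /card_gt0P[x _] /total_dominatingP domS.
have [y yS _] := domS x; have [z zS yz] := domS y.
apply/card_gt1P; exists y, z; split=> //.
by apply: contraTneq yz => ->; rewrite adj_irr.
Qed.

End TotalDomination.

(** * Trading cliques for vertices *)

Section Exchange.
Variables (H : sgraph) (B : finType) (inc : B -> H -> bool).
Hypothesis inc_clique :
  forall b x y, inc b x -> inc b y -> x != y -> adj x y.
Hypothesis noiso : forall x : H, exists y, adj x y.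

Definition dominated (W : {set H}) (x : H) := exists2 y, y \in W & adj x y.

Lemma dominatedS (W T : {set H}) x :
  W \subset T -> dominated W x -> dominated T x.
Proof. by move=> /subsetP WT [y yW xy]; exists y; first exact: WT. Qed.

(** The cliques of [D] are traded one by one.  The invariant is that each
    remaining clique contains a vertex that is in [W] or dominated by [W], or
    shares a vertex with another remaining clique.  Trading [b] for a suitable
    vertex brings all of [b] into the closed neighbourhood of [W], which
    preserves the invariant for the cliques that rely on [b]. *)
Lemma exchange_dominating (D : {set B}) (W : {set H}) :
    (forall b, b \in D ->
       (exists2 x, inc b x & x \in W \/ dominated W x)
       \/ (exists c x, [/\ c \in D, c != b, inc b x & inc c x])) ->
  exists2 T : {set H}, #|T| <= #|W| + #|D| &
    forall x, dominated W x \/ (exists2 b, b \in D & inc b x) -> dominated T x.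
Proof.
have [n] := ubnP #|D|; elim: n D W => // n IHn D W ltDn inv.
have [D0 | [b bD]] := set_0Vmem D.
  exists W; first by rewrite leq_addr.
  by move=> x [] // [c]; rewrite D0 inE.
(* All three cases of the invariant reduce to this one. *)
suff [z [z' [zb z'W bW]]] : exists z z',
    [/\ inc b z, z \in z' |: W &
        dominated (z' |: W) z \/ exists2 c, c \in D :\ b & inc c z].
  have cW x : inc b x -> x \in z' |: W \/ dominated (z' |: W) x.
    move=> bx; case: (eqVneq x z) => [-> | xz]; first by left.
    by right; exists z => //; apply: inc_clique bx zb xz.
  have [|c|T leT domT] := IHn (D :\ b) (z' |: W).
  - by move: ltDn; rewrite (cardsD1 b) bD.
  - rewrite !inE => /andP[cb cD].
    have [[x cx Wx] | [a [x [aD ac cx ax]]]] := inv c cD.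
      left; exists x => //; case: Wx => [xW | Wx].
        by left; rewrite inE xW orbT.
      by right; apply: dominatedS Wx; apply: subsetUr.
    have [ab | ab] := eqVneq a b.
      by left; exists x => //; apply: cW; rewrite -ab.
    by right; exists a, x; rewrite !inE ab aD.
  exists T.
    apply: leq_trans leT _; rewrite (cardsD1 b D) bD addnA leq_add2r.
    by rewrite cardsU1 addnC leq_add2l leq_b1.
  move=> x [Wx | [c cD cx]].
    by apply: domT; left; apply: dominatedS Wx; apply: subsetUr.
  have [cb | cb] := eqVneq c b; last first.
    by apply: domT; right; exists c; rewrite // !inE cb.
  have [-> | xz] := eqVneq x z; first exact: domT.
  by apply: domT; left; exists z; rewrite // (inc_clique (b := b)) // -cb.
have [[x bx [xW | Wx]] | [c [x [cD cb bx cx]]]] := inv b bD.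
- (* [x] already dominates the rest of [b] but may itself be undominated. *)
  have [y xy] := noiso x; exists x, y; split=> //; first by rewrite inE xW orbT.
  by left; exists y; rewrite // setU11.
- exists x, x; split; rewrite ?setU11 //.
  by left; apply: dominatedS Wx; apply: subsetUr.
- (* [x] gets dominated when [c] is traded. *)
  exists x, x; split; rewrite ?setU11 //.
  by right; exists c; rewrite // !inE cb.
Qed.

Lemma exchange_gamma_t (D : {set B}) (W : {set H}) :
    (forall x, dominated W x \/ exists2 b, b \in D & inc b x) ->
    (forall b, (exists2 x, x \in W & inc b x)
       \/ (exists2 c, c \in D & c != b /\ exists2 x, inc b x & inc c x)) ->
  gamma_t H <= #|W| + #|D|.
Proof.
move=> domH domB; have [b bD | T leT domT] := @exchange_dominating D W.
  have [[x xW bx] | [c cD [cb [x bx cx]]]] := domB b.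
    by left; exists x; last left.
  by right; exists c, x.
by apply: leq_trans leT; apply/gamma_t_leq/total_dominatingP=> x; apply: domT.
Qed.

End Exchange.

(** * Edges and mixed domination *)

Section Mixed.
Variable G : sgraph.
Implicit Types (e f : edge G) (x y z : G) (S : {set element G}).

Lemma edge_ofP x y : adj x y -> is_edge [set x; y].
Proof. by move=> xy; apply/existsP; exists x; apply/existsP; exists y; rewrite xy /=. Qed.

Definition edge_of x y (xy : adj x y) : edge G :=
  exist (fun e : {set G} => is_edge e) _ (edge_ofP xy).

Lemma edgeE e : exists x y, adj x y /\ val e = [set x; y].
Proof. by case/existsP: (valP e) => x /existsP[y /andP[xy /eqP]]; exists x, y. Qed.

Lemma in_edge_of z x y (xy : adj x y) :
  (z \in val (edge_of xy)) = (z == x) || (z == y).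
Proof. exact: in_set2. Qed.

Lemma edge_at e x : x \in val e -> exists2 y, adj x y & val e = [set x; y].
Proof.
have [u [v [uv ->]]] := edgeE e.
rewrite in_set2 => /orP[]/eqP->; first by exists v.
by exists u; rewrite 1?adj_sym 1?setUC.
Qed.

Lemma edge_adjP e f :
  reflect (e != f /\ exists2 x, x \in val e & x \in val f) (edge_adj e f).
Proof.
apply: (iffP andP) => -[ef]; first by case/existsP=> x /andP[]; split=> //; exists x.
by case=> x xe xf; split=> //; apply/existsP; exists x; apply/andP.
Qed.

Lemma edge_adjI x z e f :
  x \in val e -> x \in val f -> z \in val f -> z \notin val e -> edge_adj e f.
Proof.
move=> xe xf zf ze; apply/edge_adjP; split; last by exists x.
by apply: contraNneq ze => ->.
Qed.

Lemma edge_endpoints_adj e x y :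
  x \in val e -> y \in val e -> x != y -> adj x y.
Proof.
have [u [v [uv ->]]] := edgeE e; rewrite !inE.
by case/orP=> /eqP-> /orP[]/eqP->; rewrite ?eqxx // adj_sym.
Qed.

(** The vertex set of an edge with no adjacent edge is closed under adjacency,
    hence is the whole graph. *)
Lemma isolated_edge e :
  connected G -> (forall f, ~~ edge_adj e f) -> val e = setT /\ #|edge G| <= 1.
Proof.
move=> connG iso.
have e_closed u v : adj u v -> u \in val e -> v \in val e.
  move=> uv ue; apply: contraR (iso (edge_of uv)) => ve.
  by apply: (edge_adjI (x := u) (z := v)); rewrite // in_edge_of eqxx ?orbT.
have eT : val e = setT.
  have [x [y [_ exy]]] := edgeE e; apply/setP=> z; rewrite inE.
  have cl : closed (@adj G) (mem (val e)).
    by move=> u v uv; apply/idP/idP; apply: e_closed; rewrite // adj_sym.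
  by rewrite -(closed_connect cl (connG x z)) exy set21.
split=> //; apply/card_le1_eqP=> f g _ _.
suff eq_e h : h = e by rewrite (eq_e f) (eq_e g).
apply/eqP; rewrite eq_sym; apply: contraR (iso h) => eh.
apply/edge_adjP; split=> //; have [x [y [_ hxy]]] := edgeE h.
by exists x; rewrite ?eT ?hxy ?inE ?eqxx.
Qed.

Lemma line_graph_no_isolated :
  connected G -> 2 < #|G| -> forall e, exists f, edge_adj e f.
Proof.
move=> connG G3 e; apply/existsP; apply: contraLR G3 => /existsPn iso.
rewrite -leqNgt -cardsT; have [<- _] := isolated_edge connG iso.
by have [x [y [_ ->]]] := edgeE e; rewrite cards2; case: eqP.
Qed.

Lemma total_mixed_dominatingP S :
  reflect (forall a, exists2 b, b \in S & mixed_adj a b)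
          (total_mixed_dominating S).
Proof. by apply: (iffP forallP) => h x; apply/exists_inP/h. Qed.

Lemma gamma_tm_leq S : total_mixed_dominating S -> gamma_tm G <= #|S|.
Proof. by move=> domS; apply: bigminn_leq. Qed.

Lemma card_element_set S :
  #|S| = #|[set x | inl x \in S]| + #|[set e | inr e \in S]|.
Proof. by rewrite -!sum1dep_card -sum1_card big_sumType. Qed.

Lemma gamma_t_leq_mixed S :
  (forall x, exists y, adj x y) -> total_mixed_dominating S -> gamma_t G <= #|S|.
Proof.
move=> noiso /total_mixed_dominatingP domS; rewrite card_element_set.
apply: (exchange_gamma_t (inc := fun e x => x \in val e)) => //.
- exact: edge_endpoints_adj.
- move=> x; have [[y | e] bS xb] := domS (inl x); [left | right].
    by exists y; rewrite ?inE.
  by exists e; rewrite ?inE.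
- move=> e; have [[x | f] bS eb] := domS (inr e); [left | right].
    by exists x; rewrite ?inE.
  by exists f; rewrite ?inE // eq_sym; apply/edge_adjP.
Qed.

Lemma gamma_t_line_leq_mixed S :
    (forall e, exists f, edge_adj e f) -> total_mixed_dominating S ->
  gamma_t (line_graph G) <= #|S|.
Proof.
move=> noiso /total_mixed_dominatingP domS; rewrite card_element_set addnC.
apply: (exchange_gamma_t (H := line_graph G)
  (inc := fun x e => x \in val e)) => //.
- by move=> x e f xe xf ef; apply/edge_adjP; split=> //; exists x.
- move=> e; have [[x | f] bS eb] := domS (inr e); [right | left].
    by exists x; rewrite ?inE.
  by exists f; rewrite ?inE.
- move=> x; have [[y | e] bS xb] := domS (inl x); [right | left].
    exists y; rewrite ?inE //; split.
      by apply: contraTneq xb => ->; rewrite /= adj_irr.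
    by exists (edge_of xb); rewrite in_edge_of eqxx ?orbT.
  by exists e; rewrite ?inE.
Qed.

Lemma gamma_tm_lower :
    connected G -> (forall x, exists y, adj x y) ->
  maxn (gamma_t G) (gamma_t (line_graph G)) <= gamma_tm G.
Proof.
move=> connG noiso; apply: bigminn_geq => [|S domS].
  rewrite card_sum geq_max (leq_trans (gamma_t_leq_card _)) ?leq_addr //=.
  exact: leq_trans (gamma_t_leq_card _) (leq_addl _ _).
rewrite geq_max gamma_t_leq_mixed //=.
have [/forallP noisoL | /forallPn[e /existsPn iso]] :=
    boolP [forall e, exists f, @edge_adj G e f].
  by apply: gamma_t_line_leq_mixed => // e; apply/existsP.
have [_ leE] := isolated_edge connG iso.
apply: leq_trans (leq_trans (gamma_t_leq_card (line_graph G)) leE) _.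
have [b bS _] := (total_mixed_dominatingP S domS) (inr e).
by apply/card_gt0P; exists b.
Qed.

Lemma gamma_tm_upper :
    (forall x, exists y, adj x y) ->
  gamma_tm G <= gamma_t (line_graph G) + gamma_t G.
Proof.
move=> noiso.
have [F -> domF] := gamma_t_witness (line_graph G).
have [T -> domT] := gamma_t_witness G.
have {domT} /total_dominatingP domT : total_dominating T.
  by case: domT => // ->; apply: total_dominating_setT.
pose S : {set element G} :=
  [set a | match a with inl x => x \in T | inr e => e \in F end].
suff domS : total_mixed_dominating S.
  apply: leq_trans (gamma_tm_leq domS) _; rewrite card_element_set addnC.
  by apply: leq_add; apply/subset_leq_card/subsetP=> a; rewrite !inE.
apply/total_mixed_dominatingP=> -[x | e].
  by have [y yT xy] := domT x; exists (inl y); rewrite // inE.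
case: domF => [/total_dominatingP/(_ e)[f fF ef] | FT].
  by exists (inr f); rewrite // inE.
(* All edges are present, so a neighbour of an endpoint in [T] gives either an
   incident vertex or an adjacent edge. *)
have [x [y [_ exy]]] := edgeE e; have xe : x \in val e by rewrite exy set21.
have [z zT xz] := domT x; have [ze | ze] := boolP (z \in val e).
  by exists (inl z); rewrite // inE.
exists (inr (edge_of xz)); first by rewrite inE FT in_setT.
by apply: (edge_adjI xe (z := z)) => //; rewrite in_edge_of eqxx ?orbT.
Qed.

(** Elements with pairwise disjoint neighbourhoods need distinct dominators.
    The bound on [#|I|] is for the default value of the minimum. *)
Lemma packing_leq_gamma_tm (I : finType) (p : I -> element G) :
    #|I| <= #|element G| ->
    (forall i j b, mixed_adj (p i) b -> mixed_adj (p j) b -> i = j) ->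
  #|I| <= gamma_tm G.
Proof.
move=> leI disj; apply: bigminn_geq => // S /total_mixed_dominatingP domS.
have /fin_all_exists2[g gS pg] i := domS (p i).
have g_inj : injective g by move=> i j gij; apply: (disj i j (g i)); rewrite // gij.
by rewrite -(card_imset _ g_inj); apply/subset_leq_card/subsetP=> _ /imsetP[i _ ->].
Qed.

End Mixed.

(** * Tightness of the lower bound: a triangle *)

Definition neq_rel : rel 'I_3 := fun i j => i != j.

Lemma neq_rel_sym : symmetric neq_rel.
Proof. by move=> i j; rewrite /neq_rel eq_sym. Qed.

Lemma neq_rel_irr : irreflexive neq_rel.
Proof. by move=> i; rewrite /neq_rel eqxx. Qed.

Definition triangle : sgraph := SGraph neq_rel_sym neq_rel_irr.

Lemma triangle_connected : connected triangle.
Proof.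
by move=> x y; have [->|xy] := eqVneq x y; [apply: connect0 | apply: connect1].
Qed.

Lemma triangle_no_isolated (x : triangle) : exists y, adj x y.
Proof.
case: x => -[|i] lti; [exists (inord 1) | exists ord0];
  by rewrite /adj/= /neq_rel -val_eqE /= ?inordK.
Qed.

Lemma triangle_tight :
  maxn (gamma_t triangle) (gamma_t (line_graph triangle)) = gamma_tm triangle.
Proof.
have lower := gamma_tm_lower triangle_connected triangle_no_isolated.
apply/eqP; rewrite eqn_leq lower /=; apply: (@leq_trans 2); last first.
  rewrite leq_max bigminn_geq //; first by rewrite card_ord.
  by move=> S; apply: total_dominating_gt1; rewrite card_ord.
pose S : {set element triangle} := [set inl ord0; inl (lift ord0 ord0)].
apply: (@leq_trans #|S|); last by rewrite cards2; case: eqP.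
apply/gamma_tm_leq/total_mixed_dominatingP=> -[x | e].
  case: (eqVneq x ord0) => [-> | x0].
    by exists (inl (lift ord0 ord0)); rewrite // set22.
  by exists (inl ord0); rewrite // set21.
have [x [y [xy exy]]] := edgeE e.
(* Of three vertices, two distinct ones cannot both avoid the chosen pair. *)
suff [z zS ze] : exists2 z : triangle, inl z \in S & z \in [set x; y].
  by exists (inl z); rewrite //= /incident exy.
move: xy; rewrite /adj /= /neq_rel -val_eqE.
case: x y {exy} => [[|[|[|//]]] ltx] [[|[|[|//]]] lty] //= _;
  by [exists ord0; rewrite !inE -?val_eqE ?orbT
     |exists (lift ord0 ord0); rewrite !inE -?val_eqE ?orbT].
Qed.

(** * Tightness of the upper bound: two hubs with glued triangles *)

(** In each of the two copies, [None] is the hub, [Some None] its leaf and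
    [Some (Some (k, i))] the end [i] of the base of the [k]-th triangle. *)
Definition hub_vertex : finType := (bool * option (option (bool * bool)))%type.

Definition hub_adj : rel hub_vertex := fun x y =>
  match x.2, y.2 with
  | None, None => x.1 != y.1
  | None, Some _ | Some _, None => x.1 == y.1
  | Some p, Some q =>
      if (p, q) is (Some (k, i), Some (l, j))
      then [&& x.1 == y.1, k == l & i != j] else false
  end.

Lemma hub_adj_sym : symmetric hub_adj.
Proof.
by case=> [[] [[[[] []]|]|]] [[] [[[[] []]|]|]].
Qed.

Lemma hub_adj_irr : irreflexive hub_adj.
Proof. by case=> [[] [[[[] []]|]|]]. Qed.

Definition hubs : sgraph := SGraph hub_adj_sym hub_adj_irr.

Definition hub s : hubs := (s, None).
Definition leaf s : hubs := (s, Some None).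
Definition base_end s k i : hubs := (s, Some (Some (k, i))).

Lemma spoke_adj s k : adj (hub s) (base_end s k true).
Proof. exact: eqxx. Qed.

Definition spoke s k : edge hubs := edge_of (spoke_adj s k).

Lemma base_adj s k : adj (base_end s k true) (base_end s k false).
Proof. by rewrite /adj /= /hub_adj /= !eqxx. Qed.

Definition base s k : edge hubs := edge_of (base_adj s k).

Lemma hubs_no_isolated (x : hubs) : exists y, adj x y.
Proof.
case: x => s [p|]; first by exists (hub s); apply: eqxx.
by exists (leaf s); apply: eqxx.
Qed.

Lemma hubs_connected : connected hubs.
Proof.
have csym : connect_sym (@adj hubs) by apply: sym_connect_sym; apply: adj_sym.
have to_hub (x : hubs) : connect (@adj hubs) x (hub true).
  have hubT s : connect (@adj hubs) (hub s) (hub true).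
    by case: s; [apply: connect0 | apply: connect1].
  case: x => s [p|]; last exact: hubT.
  by apply: connect_trans (hubT s); apply: connect1; apply: eqxx.
by move=> x y; apply: connect_trans (to_hub x) _; rewrite csym.
Qed.

Lemma card_hubs : #|hubs| = 12.
Proof. by rewrite card_prod !card_option card_prod !card_bool. Qed.

Lemma gamma_t_hubs : gamma_t hubs <= 2.
Proof.
pose S := [set hub true; hub false].
apply: (@leq_trans #|S|); last by rewrite cards2; case: eqP.
apply/gamma_t_leq/total_dominatingP=> -[s [p|]].
  by exists (hub s); [rewrite !inE; case: s | apply: eqxx].
by exists (hub (~~ s)); [rewrite !inE; case: s | case: s].
Qed.

Lemma gamma_t_line_hubs : gamma_t (line_graph hubs) <= 4.
Proof.
pose F : {set line_graph hubs} := [set spoke c.1 c.2 | c : bool * bool].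
apply: (@leq_trans #|F|); last first.
  by apply: leq_trans (leq_imset_card _ _) _; rewrite card_prod card_bool.
have spokeF s k : spoke s k \in F by apply/imsetP; exists (s, k).
apply/gamma_t_leq/total_dominatingP=> e; have [x [y [xy exy]]] := edgeE e.
suff [s [k [u [v [ue us vs ve]]]]] : exists s k u v,
    [/\ u \in [set x; y], u \in val (spoke s k),
        v \in val (spoke s k) & v \notin [set x; y]].
  by exists (spoke s k) => //; apply: (edge_adjI (x := u) (z := v)); rewrite ?exy.
(* An edge at a hub is adjacent to a spoke there; a base to the spoke at it. *)
wlog : x y xy {exy} / y = hub y.1 \/ (x.2 != None /\ y.2 != None).
  move=> IH; case: (eqVneq y.2 None) => [y2 | y2].
    by apply: (IH x y xy); left; case: y y2 {xy exy IH} => ? ? /= ->.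
  case: (eqVneq x.2 None) => [x2 | x2]; last by apply: (IH x y xy); right.
  rewrite setUC; apply: IH; first by rewrite adj_sym.
  by left; case: x x2 {xy exy} => ? ? /= ->.
case: y xy => t q xy [-> /= | /= [x2 q0]].
  pose k := x != base_end t true true.
  exists t, k, (hub t), (base_end t k true).
  rewrite !inE !eqxx !orbT; split=> //.
  rewrite negb_or; apply/andP; split; last by case: (t).
  rewrite eq_sym {}/k; case: (eqVneq x (base_end t true true)) => [->|] //.
  by case: (t).
case: x q xy x2 q0 => s [[[k i]|]|] [[[l j]|]|] //=.
move=> /and3P[/eqP/= <- /eqP/= <- ij] _ _.
exists s, k, (base_end s k true), (hub s).
rewrite !inE !eqxx !orbT; split=> //; last by case: (s).
by case: i j ij => [] []; rewrite ?eqxx ?orbT.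
Qed.

(** The packing: the leaves and the bases.  Using the edges between hub and leaf
    instead of the leaves would fail, as both are adjacent to the edge that
    joins the hubs. *)
Definition center (c : bool * option bool) : element hubs :=
  if c.2 is Some k then inr (base c.1 k) else inl (leaf c.1).

Definition block (x : hubs) : bool * option bool :=
  (x.1, if x.2 is Some (Some (k, _)) then Some k else None).

Lemma center_vertex c x : mixed_adj (center c) (inl x) -> block x = c.
Proof.
case: c => s [k|]; rewrite /center /= ?/incident.
  by rewrite /base in_edge_of => /orP[]/eqP->.
by case: x => t [[[]|]|] //= /eqP/= ->.
Qed.

(** An edge adjacent to a base shares just one end with it, so its other end is
    the hub.  Hence [f] determines [x] as its end that is not a hub, and
    [block x] recovers [c]. *)
Lemma center_edge c f : mixed_adj (center c) (inr f) ->
  exists x, [/\ val f = [set hub c.1; x], x.2 != None & block x = c].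
Proof.
case: c => s [k fk | fl]; last first.
  have [y ly fE] : exists2 y, adj (leaf s) y & val f = [set leaf s; y].
    exact: edge_at fl.
  rewrite fE; exists (leaf s); split=> //; rewrite setUC.
  by case: y ly {fE} => t [[[]|]|] // /eqP/= <-.
have /edge_adjP[basef [z]] : edge_adj (base s k) f := fk.
rewrite /base in_edge_of => zb zf.
have [i zE] : exists i, z = base_end s k i.
  by case/orP: zb => /eqP->; [exists true | exists false].
have [y zy fE] : exists2 y, adj z y & val f = [set z; y] by exact: edge_at.
rewrite {}zE {zf zb} in zy fE.
rewrite fE; exists (base_end s k i); split=> //; rewrite setUC.
case: y zy fE => t [[[l j]|]|] // =>
  [/and3P[/eqP/= st /eqP kl ij] fE | /eqP/= <- //].
(* The other end of the base: then [f] would be the base itself. *)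
subst t l; case/eqP: basef; apply/val_inj/esym/(etrans fE).
by case: i j ij {fE} => [] [] //= _; rewrite setUC.
Qed.

Lemma center_disjoint c d b :
  mixed_adj (center c) b -> mixed_adj (center d) b -> c = d.
Proof.
case: b => [x | f]; first by move=> /center_vertex<- /center_vertex.
move=> /center_edge[x [fx x0 <-]] /center_edge[y [fy y0 <-]].
have : y \in val f by rewrite fy set22.
rewrite fx in_set2 => /orP[]/eqP yE; last by rewrite yE.
by rewrite yE in y0.
Qed.

Lemma gamma_tm_hubs : 6 <= gamma_tm hubs.
Proof.
have cardI : #|{: bool * option bool}| = 6.
  by rewrite card_prod card_option card_bool.
rewrite -cardI; apply: packing_leq_gamma_tm center_disjoint.
by rewrite cardI card_sum card_hubs (leq_trans _ (leq_addr _ _)).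
Qed.

(** * Bounds on the total mixed domination number *)

Theorem theorem2p2 :
  (forall G : sgraph,
     0 < #|G| -> connected G -> 1 <= min_degree G ->
     maxn (gamma_t G) (gamma_t (line_graph G)) <= gamma_tm G
     /\ gamma_tm G <= gamma_t (line_graph G) + gamma_t G)
  /\ (exists G : sgraph,
       [/\ 0 < #|G|, connected G, 1 <= min_degree G,
           (exists F : {set line_graph G}, total_dominating F)
         & maxn (gamma_t G) (gamma_t (line_graph G)) = gamma_tm G])
  /\ (exists G : sgraph,
       [/\ 0 < #|G|, connected G, 1 <= min_degree G,
           (exists F : {set line_graph G}, total_dominating F)
         & gamma_tm G = gamma_t (line_graph G) + gamma_t G]).
Proof.
split; last split.
- move=> G G0 connG /(min_degree_gt0 G0) noiso.
  by split; [apply: gamma_tm_lower | apply: gamma_tm_upper].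
- have G0 : 0 < #|triangle| by rewrite card_ord.
  exists triangle; split=> //.
  + exact: triangle_connected.
  + exact/(min_degree_gt0 G0)/triangle_no_isolated.
  + exists setT; apply: total_dominating_setT.
    by apply: (line_graph_no_isolated triangle_connected); rewrite card_ord.
  + exact: triangle_tight.
- have G0 : 0 < #|hubs| by rewrite card_hubs.
  exists hubs; split=> //.
  + exact: hubs_connected.
  + exact/(min_degree_gt0 G0)/hubs_no_isolated.
  + exists setT; apply: total_dominating_setT.
    by apply: (line_graph_no_isolated hubs_connected); rewrite card_hubs.
  + apply/eqP; rewrite eqn_leq (gamma_tm_upper hubs_no_isolated) /=.
    apply: leq_trans gamma_tm_hubs.
    exact: leq_add gamma_t_line_hubs gamma_t_hubs.
Qed.
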